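(* Let $n\ge 3$ and let $F_n^1$ be the complex $n$-dimensional Leibniz algebra with basis $\{x_1,\dots,x_n\}$ and multiplication $[x_i,x_1]=x_{i+1}$ for $2\le i\le n-1$ (all other products of basis elements are zero). The following cochains (bilinear maps $F_n^1\times F_n^1\to F_n^1$, with all values on pairs of basis elements not listed equal to zero) form a basis of the space $ZL^2(F_n^1,F_n^1)$: - $\varphi_{j,1}$ for $2\le j\le n-1$: $\varphi_{j,1}(x_j,x_1)=x_1$ and $\varphi_{j,1}(x_i,x_{j+1})=-x_{i+1}$ for $2\le i\le n-1$; - $\varphi_{j,k}$ for $1\le j\le n$, $2\le k\le n$: $\varphi_{j,k}(x_j,x_1)=x_k$; - $\psi_j$ for $2\le j\le n$: $\psi_j(x_i,x_2)=x_{j+i-2}$ for $2\le i\le n-j+2$; - $\xi_1$: $\xi_1(x_1,x_2)=x_1$, $\xi_1(x_i,x_2)=(i-2)x_i$ for $3\le i\le n$, and $\xi_1(x_i,x_3)=-x_{i+1}$ for $2\le i\le n-1$; - $\xi_2$: $\xi_2(x_1,x_2)=x_n$.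
   Context: A Leibniz algebra over $\mathbb{C}$ is a vector space $L$ with a bilinear bracket satisfying $[x,[y,z]]=[[x,y],z]-[[x,z],y]$ for all $x,y,z$. $ZL^2(L,L)$ denotes the space of $2$-cocycles (infinitesimal deformations): bilinear maps $\varphi:L\times L\to L$ with $$[x,\varphi(y,z)]-[\varphi(x,y),z]+[\varphi(x,z),y]+\varphi(x,[y,z])-\varphi([x,y],z)+\varphi([x,z],y)=0$$ for all $x,y,z\in L$. *)

(* Defs.v *)
From HB Require Import structures.
From mathcomp Require Import all_boot all_algebra.

Set Implicit Arguments.
Unset Strict Implicit.
Unset Printing Implicit Defensive.

Import GRing.Theory.
Local Open Scope ring_scope.

Lemma linfun_linearE (K : fieldType) (U V : vectType K) (f : U -> V) :
  linear f -> forall u, linfun f u = f u.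
Proof.
move=> lin_f; pose m := GRing.isLinear.Build K U V *:%R f lin_f.
pose g : {linear U -> V} := HB.pack f m.
exact: (lfunE g).
Qed.

(* Bilinear maps L * L -> L in curried form, so that they form a vectType. *)
Definition cochain2 (K : fieldType) (L : vectType K) : vectType K :=
  'Hom(L, 'Hom(L, L)).

Record leibnizAlg (K : fieldType) (L : vectType K) := LeibnizAlg {
  bracket : cochain2 L;
  leibniz_identity : forall x y z : L,
    bracket x (bracket y z) =
      bracket (bracket x y) z - bracket (bracket x z) y
}.

Section Cocycles.
Variables (K : fieldType) (L : vectType K) (A : leibnizAlg L).
Local Notation br := (bracket A).

Definition cocycle_expr (phi : cochain2 L) (x y z : L) : L :=
  br x (phi y z) - br (phi x y) z + br (phi x z) y
  + phi x (br y z) - phi (br x y) z + phi (br x z) y.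

(* linfun needs no linearity proof but is meaningful only on linear maps;
   coboundaryE and mem_ZL2 discharge this. *)
Definition coboundary :
    'Hom(cochain2 L, 'Hom(L, 'Hom(L, 'Hom(L, L)))) :=
  linfun (fun phi : cochain2 L =>
    linfun (fun x => linfun (fun y => linfun (cocycle_expr phi x y)))).

Definition ZL2 : {vspace cochain2 L} := lker coboundary.

Lemma coboundaryE (phi : cochain2 L) (x y z : L) :
    coboundary phi x y z = cocycle_expr phi x y z.
Proof.
have sumE (V : lmodType K) (a : K) (u1 u2 u3 u4 u5 u6 v1 v2 v3 v4 v5 v6 : V) :
    (a *: u1 + v1) - (a *: u2 + v2) + (a *: u3 + v3) + (a *: u4 + v4)
    - (a *: u5 + v5) + (a *: u6 + v6)
  = a *: (u1 - u2 + u3 + u4 - u5 + u6) + (v1 - v2 + v3 + v4 - v5 + v6).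
  have addE p q r t : (a *: p + q) + (a *: r + t) = a *: (p + r) + (q + t) :> V.
    by rewrite scalerDr addrACA.
  have oppE p q : - (a *: p + q) = a *: - p - q :> V.
    by rewrite opprD scalerN.
  by rewrite !oppE !addE.
have lfunL (U V : vectType K) (g : 'Hom(U, V)) a u v :
    g (a *: u + v) = a *: g u + g v by rewrite linearP.
have lfunL2 (U V : vectType K) (g h : 'Hom(U, V)) a u :
    (a *: g + h) u = a *: g u + h u by rewrite add_lfunE scale_lfunE.
have linz f s t : linear (cocycle_expr f s t).
  move=> a u v; rewrite /cocycle_expr.
  by rewrite !(lfunL, lfunL2) sumE.
have liny f s : linear (fun t => linfun (cocycle_expr f s t)).
  move=> a u v; apply/lfunP => w.
  rewrite add_lfunE scale_lfunE !linfun_linearE // /cocycle_expr.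
  by rewrite !(lfunL, lfunL2) sumE.
have linx f : linear (fun s => linfun (fun t => linfun (cocycle_expr f s t))).
  move=> a u v; apply/lfunP => t; apply/lfunP => w.
  rewrite !(add_lfunE, scale_lfunE) !(linfun_linearE (liny _ _)).
  rewrite !(linfun_linearE (linz _ _ _)) /cocycle_expr.
  by rewrite !(lfunL, lfunL2) sumE.
rewrite /coboundary linfun_linearE.
  by rewrite !(linfun_linearE (linx _), linfun_linearE (liny _ _),
               linfun_linearE (linz _ _ _)).
move=> a f g; apply/lfunP => s; apply/lfunP => t; apply/lfunP => w.
rewrite !(add_lfunE, scale_lfunE) !(linfun_linearE (linx _)).
rewrite !(linfun_linearE (liny _ _)) !(linfun_linearE (linz _ _ _)).
by rewrite /cocycle_expr !(lfunL, lfunL2) sumE.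
Qed.

Lemma mem_ZL2 (phi : cochain2 L) :
  reflect (forall x y z : L,
      br x (phi y z) - br (phi x y) z + br (phi x z) y
      + phi x (br y z) - phi (br x y) z + phi (br x z) y = 0)
    (phi \in ZL2).
Proof.
rewrite memv_ker; apply: (iffP eqP) => [d0 x y z | H].
  by rewrite -[LHS]coboundaryE d0 !zero_lfunE.
apply/lfunP => x; apply/lfunP => y; apply/lfunP => z.
by rewrite coboundaryE !zero_lfunE; apply: H.
Qed.

End Cocycles.

Section FiliformLeibniz.
Variables (K : fieldType) (n : nat).
Local Notation L := 'rV[K]_n.

(* Basis vectors are numbered from 1: for 1 <= i <= n, bvec i is the i-th
   vector of the standard basis; bvec i = 0 for other i. *)
Definition bvec (i : nat) : L := \row_(j < n) (j.+1 == i)%:R.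

(* The bilinear map whose value at (x_i, x_j) is f i j; see bilin_bvec. *)
Definition bilin (f : nat -> nat -> L) : cochain2 L :=
  linfun (fun u : L => linfun (fun v : L =>
    \sum_(i < n) \sum_(j < n) (u 0 i * v 0 j) *: f i.+1 j.+1)).

Lemma bilinE f (u v : L) :
  bilin f u v = \sum_(i < n) \sum_(j < n) (u 0 i * v 0 j) *: f i.+1 j.+1.
Proof.
have linv (s : L) : linear (fun t : L =>
    \sum_(i < n) \sum_(j < n) (s 0 i * t 0 j) *: f i.+1 j.+1).
  move=> a t w; rewrite scaler_sumr -big_split /=; apply: eq_bigr => i _.
  rewrite scaler_sumr -big_split /=; apply: eq_bigr => j _.
  by rewrite !mxE mulrDr scalerDl scalerA mulrCA.
rewrite /bilin linfun_linearE ?linfun_linearE // => a s t.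
apply/lfunP => w; rewrite add_lfunE scale_lfunE !(linfun_linearE (linv _)).
rewrite scaler_sumr -big_split /=; apply: eq_bigr => i _.
rewrite scaler_sumr -big_split /=; apply: eq_bigr => j _.
by rewrite !mxE mulrDl scalerDl scalerA mulrA.
Qed.

Lemma bilin_bvec f i j :
  (1 <= i <= n)%N -> (1 <= j <= n)%N -> bilin f (bvec i) (bvec j) = f i j.
Proof.
case: i j => [|i] [|j] //= lt_in lt_jn; rewrite bilinE.
rewrite (bigD1 (Ordinal lt_in)) //= (bigD1 (Ordinal lt_jn)) //= !mxE !eqxx.
rewrite mulr1 scale1r big1 ?addr0 ?big1 ?addr0 // => k.
  rewrite -val_eqE /= => ne_k; apply: big1 => l _.
  by rewrite !mxE eqSS (negPf ne_k) mul0r scale0r.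
by rewrite -val_eqE /= => ne_k; rewrite !mxE eqSS (negPf ne_k) mulr0 scale0r.
Qed.

Definition F1_bracket : cochain2 L :=
  bilin (fun i j =>
    if (2 <= i <= n.-1)%N && (j == 1%N) then bvec i.+1 else 0).

End FiliformLeibniz.

Lemma F1_bracketE (K : fieldType) (n : nat) (u v : 'rV[K]_n.+1) :
  F1_bracket K n.+1 u v = v 0 0 *: F1_bracket K n.+1 u (bvec K n.+1 1).
Proof.
rewrite !bilinE scaler_sumr; apply: eq_bigr => i _.
rewrite [in LHS](bigD1 ord0) //= [in RHS](bigD1 ord0) //= !big1 ?addr0.
- by rewrite scalerA !mxE eqxx mulr1 mulrC.
- by move=> [[|j] ltj] //= _; rewrite andbF scaler0.
- by move=> [[|j] ltj] //= _; rewrite andbF scaler0.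
Qed.

Lemma F1_bracket_coord0 (K : fieldType) (n : nat) (u v : 'rV[K]_n.+1) :
  F1_bracket K n.+1 u v 0 0 = 0.
Proof.
rewrite bilinE summxE big1 // => i _; rewrite summxE big1 // => j _.
by rewrite mxE; case: ifP => _; rewrite mxE /= ?mulr0.
Qed.

Lemma F1_leibniz (K : fieldType) (n : nat) (x y z : 'rV[K]_n) :
  F1_bracket K n x (F1_bracket K n y z) =
    F1_bracket K n (F1_bracket K n x y) z
    - F1_bracket K n (F1_bracket K n x z) y.
Proof.
case: n x y z => [|n] x y z; first by rewrite [LHS]thinmx0 [RHS]thinmx0.
rewrite F1_bracketE F1_bracket_coord0 scale0r.
rewrite [F1_bracket K n.+1 x y]F1_bracketE [F1_bracket K n.+1 x z]F1_bracketE.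
rewrite !linearZ /= !scale_lfunE.
rewrite [F1_bracket K n.+1 _ z]F1_bracketE [F1_bracket K n.+1 _ y]F1_bracketE.
by rewrite !scalerA mulrC subrr.
Qed.

Definition F1 (K : fieldType) (n : nat) : leibnizAlg 'rV[K]_n :=
  LeibnizAlg (@F1_leibniz K n).

Section CocycleFamily.
Variables (K : fieldType) (n : nat).
Local Notation cochain := (cochain2 'rV[K]_n).
Local Notation bvec := (bvec K n).

Definition phi1 (j : nat) : cochain :=
  bilin (fun a b =>
    if (a == j) && (b == 1%N) then bvec 1
    else if (2 <= a <= n.-1)%N && (b == j.+1) then - bvec a.+1
    else 0).

Definition phi (j k : nat) : cochain :=
  bilin (fun a b => if (a == j) && (b == 1%N) then bvec k else 0).

Definition psi (j : nat) : cochain :=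
  bilin (fun a b =>
    if (2 <= a <= n - j + 2)%N && (b == 2%N) then bvec (j + a - 2)%N else 0).

Definition xi1 : cochain :=
  bilin (fun a b =>
    if (a == 1%N) && (b == 2%N) then bvec 1
    else if (3 <= a <= n)%N && (b == 2%N) then (a - 2)%:R *: bvec a
    else if (2 <= a <= n.-1)%N && (b == 3%N) then - bvec a.+1
    else 0).

Definition xi2 : cochain :=
  bilin (fun a b => if (a == 1%N) && (b == 2%N) then bvec n else 0).

Definition ZL2_family : seq cochain :=
  [seq phi1 j | j <- index_iota 2 n]
  ++ [seq phi j k | j <- index_iota 1 n.+1, k <- index_iota 2 n.+1]
  ++ [seq psi j | j <- index_iota 2 n.+1]
  ++ [:: xi1; xi2].

End CocycleFamily.

(* Main.v *)
Require Import Defs.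
From HB Require Import structures.
From mathcomp Require Import all_boot all_algebra zify.
From mathcomp Require Import reals complex.

Set Implicit Arguments.
Unset Strict Implicit.
Unset Printing Implicit Defensive.

Import GRing.Theory.
Local Open Scope ring_scope.

(** Write [N] for right multiplication by [x_1]: it sends [x_i] to [x_(i+1)]
for [i >= 2] and kills [x_1]. As [[u, v] = v_1 *: N u], where [v_1] is the
coordinate of [v] along [x_1], the cocycle equation for [f] evaluated at
[(x, x_b, x_d)] involves only [N], the operators [f(-, x_b)] and the scalars
[c(b, d) = f(x_b, x_d)_1]. It is thereby equivalent ([F1_cocycleP]) to:
 - [c(1, 1) = 0], and [c(b, d) = 0] for [b, d >= 2];
 - [f(-, x_(b+1)) = - (c(1, b) + c(b, 1)) N] for [b >= 2], with [x_(n+1) = 0];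
 - [f(N -, x_b) = c(1, b) N + N f(-, x_b)] for [b >= 2].

The second condition gives all the operators [f(-, x_b)] with [b >= 3]. As
[N x_1 = 0] it also gives [c(1, b) = 0] for [b >= 3], and the case [b = n] then
gives [c(n, 1) = 0]. The third condition propagates [f(x_2, x_2)] to all the
[f(x_a, x_2)] with [a >= 2]; for [a = 1] it says that [f(x_1, x_2)] is killed by
[N], which leaves its coordinates along [x_1] and [x_n].
So a cocycle is determined ([cocycle_eq0]) by
 - [f(x_j, x_1)_1] for [2 <= j <= n - 1];
 - [f(x_j, x_1)_k] for [k >= 2];
 - [f(x_2, x_2)_k] for [k >= 2];
 - [f(x_1, x_2)_1] and [f(x_1, x_2)_n].
The proposed family, read in the order in which it is listed, is dual to this
list of linear forms ([coord_dual]): each member is the cocycle for which one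
of these coordinates is 1 and all the others vanish. A family of elements of a
space that is dual to linear forms separating the points of that space is a
basis of it ([basis_of_dual]). The argument works over any field. *)

(** * Bases from dual linear forms *)

(** The values of the forms are the coefficients: a vanishing combination has
zero coefficients because the forms read them off, and subtracting from [u]
the combination with coefficients [l i u] leaves a vector of [U] on which all
the forms vanish. *)
Lemma basis_of_dual (K : fieldType) (V : vectType K) (U : {vspace V})
    (I : eqType) (s : seq I) (F : I -> V) (l : I -> V -> K) :
    uniq s -> (forall i, scalar (l i)) ->
    {in s &, forall i j, l i (F j) = (i == j)%:R} ->
    {in s, forall i, F i \in U} ->
    (forall u, u \in U -> {in s, forall i, l i u = 0} -> u = 0) ->
  basis_of U [seq F i | i <- s].
Proof.
move=> s_uniq l_lin l_F F_U l_inj.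
pose L i : {linear V -> K | *%R} :=
  HB.pack (l i) (GRing.isLinear.Build K V K *%R (l i) (l_lin i)).
have lB i u v : l i (u - v) = l i u - l i v by exact: (linearB (L i)).
have l0 i : l i 0 = 0 by exact: (linear0 (L i)).
have lZ i a u : l i (a *: u) = a * l i u by exact: (scalarZ (L i)).
have lsum i (J : Type) (r : seq J) P (G : J -> V) :
    l i (\sum_(j <- r | P j) G j) = \sum_(j <- r | P j) l i (G j).
  exact: (linear_sum (L i)).
rewrite /basis_of; apply/andP; split.
  rewrite eqEsubv; apply/andP; split.
    by apply/span_subvP => _ /mapP[i si ->]; apply: F_U.
  apply/subvP => u Uu.
  have Su : \sum_(i <- s) l i u *: F i \in <<[seq F i | i <- s]>>%VS.
    rewrite big_seq; apply: memv_suml => i si.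
    by apply/memvZ/memv_span/map_f.
  rewrite -(subrK (\sum_(i <- s) l i u *: F i) u) (_ : _ - _ = 0) ?add0r //.
  apply: l_inj => [|i si].
    rewrite memvB // big_seq; apply: memv_suml => i si.
    by apply/memvZ/F_U.
  rewrite lB lsum (bigD1_seq i) //= big_seq_cond big1.
    by rewrite lZ l_F // eqxx mulr1 addr0 subrr.
  by move=> j /andP[sj ne_ji]; rewrite lZ l_F // eq_sym (negPf ne_ji) mulr0.
apply/(@freeP _ _ _ (in_tuple [seq F i | i <- s])) => k sum0 i /=.
have lt_i : (i < size s)%N by rewrite -(size_map F).
have /hasP[x0 _ _] : has predT s by rewrite has_predT (leq_ltn_trans _ lt_i).
have si : nth x0 s i \in s by apply: mem_nth.
have := congr1 (l (nth x0 s i)) sum0.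
rewrite l0 lsum (bigD1 i) //= big1 => [|j].
  by rewrite lZ (nth_map x0) // l_F // eqxx mulr1 addr0.
rewrite -val_eqE /= => ne_ji.
have lt_j : (j < size s)%N by rewrite -(size_map F).
rewrite lZ (nth_map x0) // l_F ?mem_nth // nth_uniq //.
by rewrite eq_sym (negPf ne_ji) mulr0.
Qed.

(** * Coordinates in the standard basis *)

Section Coordinates.
Variables (K : fieldType) (n : nat).
Local Notation L := 'rV[K]_n.
Local Notation e := (bvec K n).

(** The dot product with [e k] rather than a matrix entry, so that the index
runs over the same 1-based natural numbers as [bvec], with value 0 out of
range. *)
Definition bcoef (k : nat) (v : L) : K := (v *m (e k)^T) 0 0.

Fact bcoef_scalar k : scalar (bcoef k).
Proof. by move=> a u v; rewrite /bcoef mulmxDl -scalemxAl !mxE. Qed.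

HB.instance Definition _ k :=
  GRing.isLinear.Build K L K *%R (bcoef k) (bcoef_scalar k).

Lemma bcoefE (j : 'I_n) (v : L) : bcoef j.+1 v = v 0 j.
Proof.
rewrite /bcoef mxE (bigD1 j) //= !mxE eqxx mulr1 big1 ?addr0 // => i ne_ij.
by rewrite !mxE eqSS val_eqE (negPf ne_ij) mulr0.
Qed.

Lemma bvec_out a : ~~ (0 < a <= n)%N -> e a = 0.
Proof.
move=> out; apply/rowP => j; rewrite !mxE.
by case: eqP => // def_a; have := ltn_ord j; lia.
Qed.

Lemma bcoef_bvec k a : bcoef k (e a) = ((a == k) && (0 < k <= n)%N)%:R.
Proof.
have [|out] := boolP (0 < k <= n)%N; last first.
  by rewrite /bcoef (bvec_out out) trmx0 mulmx0 mxE andbF.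
case: k => // k lt_kn; rewrite (bcoefE (Ordinal lt_kn)) mxE andbT /=.
by rewrite eq_sym.
Qed.

Lemma bcoef_inj (u v : L) :
  (forall k, (0 < k <= n)%N -> bcoef k u = bcoef k v) -> u = v.
Proof.
by move=> eq_uv; apply/rowP => j; rewrite -!bcoefE eq_uv //= ltn_ord.
Qed.

Lemma bvec_sum (u : L) : u = \sum_(j < n) u 0 j *: e j.+1.
Proof.
rewrite {1}[u]row_sum_delta; apply: eq_bigr => j _; congr (_ *: _).
by apply/rowP => i; rewrite !mxE eqSS val_eqE.
Qed.

Lemma lfun_bvec (V : vectType K) (f g : 'Hom(L, V)) :
  (forall a, (0 < a <= n)%N -> f (e a) = g (e a)) -> f = g.
Proof.
move=> eq_fg; apply/lfunP => u; rewrite [u]bvec_sum !linear_sum.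
by apply: eq_bigr => j _; rewrite !linearZ /= eq_fg //= ltn_ord.
Qed.

Lemma bilin_bvecE f a b :
  bilin f (e a) (e b) =
    if (0 < a <= n)%N && (0 < b <= n)%N then f a b else 0.
Proof.
case: ifP => [/andP[a_in b_in] | /negbT]; first exact: bilin_bvec.
case/nandP => out; first by rewrite (bvec_out out) linear0 zero_lfunE.
by rewrite (bvec_out out) linear0.
Qed.
End Coordinates.

(** * The cocycle equations *)

Section Cocycles.
Variables (K : fieldType) (n : nat).
Local Notation L := 'rV[K]_n.
Local Notation e := (bvec K n).
Local Notation N u := (F1_bracket K n u (e 1%N)).

Lemma F1_bracket_bcoef (u v : L) : F1_bracket K n u v = bcoef 1 v *: N u.
Proof.
case: n u v => [|m] u v; first by rewrite [LHS]thinmx0 [RHS]thinmx0.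
by rewrite F1_bracketE -(bcoefE ord0).
Qed.

Lemma shift_bvec a : N (e a) = if (1 < a)%N then e a.+1 else 0.
Proof.
rewrite bilin_bvecE eqxx andbT.
case: ifP => [in_n | out].
  by do 2?case: ifP => // ?; try lia; rewrite bvec_out //; lia.
by case: ifP => // gt1; rewrite bvec_out //; lia.
Qed.

(** Hence the kernel of [N] is spanned by [x_1] and [x_n]. *)
Lemma bcoef_shift k u : (1 < k < n)%N -> bcoef k.+1 (N u) = bcoef k u.
Proof.
move=> k_in; rewrite {1}[u]bvec_sum {2}[u]bvec_sum !linear_sum sum_lfunE.
rewrite linear_sum; apply: eq_bigr => j _.
rewrite linearZ scale_lfunE !scalarZ /= shift_bvec; congr (_ * _).
case: ifP => [gt1 | le1]; last first.
  by rewrite linear0 bcoef_bvec; case: eqP => // jk; lia.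
by rewrite !bcoef_bvec eqSS; congr (_ && _)%:R; lia.
Qed.

Section Equations.
Variables (f : cochain2 L).
Hypothesis n_gt2 : (2 < n)%N.
Local Notation c a b := (bcoef 1 (f (e a) (e b))).
Local Notation E := (cocycle_expr (F1 K n) f).

Lemma cocycle_expr_shift x y z :
  E x y z =
    bcoef 1 (f y z) *: N x - bcoef 1 z *: N (f x y) + bcoef 1 y *: N (f x z)
    + bcoef 1 z *: f x (N y) - bcoef 1 y *: f (N x) z + bcoef 1 z *: f (N x) y.
Proof.
have br (u v : L) := F1_bracket_bcoef u v.
rewrite /cocycle_expr /= (br x (f y z)) (br _ z) (br _ y).
rewrite (br y z) (br x y) (br x z).
rewrite [f x (_ *: _)]linearZ ![f (_ *: _)]linearZ /= !scale_lfunE.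
by do ?congr (_ + _).
Qed.

Lemma bcoef1 : bcoef 1 (e 1%N) = 1.
Proof. by rewrite bcoef_bvec eqxx /= (ltn_trans _ n_gt2). Qed.

Lemma bcoef1_bvec b : (1 < b)%N -> bcoef 1 (e b) = 0.
Proof. by move=> b_gt1; rewrite bcoef_bvec; case: eqP => // eb; lia. Qed.

Lemma shift1 : N (e 1%N) = 0.
Proof. by rewrite shift_bvec. Qed.

Lemma shift2_neq0 : N (e 2%N) != 0.
Proof.
rewrite shift_bvec /=; apply/eqP => /(congr1 (bcoef 3))/eqP.
by rewrite bcoef_bvec eqxx n_gt2 linear0 oner_eq0.
Qed.

Lemma cocycle_expr11 x : E x (e 1%N) (e 1%N) = c 1%N 1%N *: N x.
Proof.
by rewrite cocycle_expr_shift bcoef1 shift1 !scale1r linear0 addr0 !subrK.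
Qed.

Lemma cocycle_expr1b x b : (1 < b)%N ->
  E x (e 1%N) (e b) = c 1%N b *: N x + N (f x (e b)) - f (N x) (e b).
Proof.
move=> b_gt1; rewrite cocycle_expr_shift bcoef1 bcoef1_bvec //.
by rewrite !scale1r !scale0r subr0 !addr0.
Qed.

Lemma cocycle_exprb1 x b : (1 < b)%N ->
  E x (e b) (e 1%N) =
    c b 1%N *: N x - N (f x (e b)) + f x (e b.+1) + f (N x) (e b).
Proof.
move=> b_gt1; rewrite cocycle_expr_shift bcoef1 bcoef1_bvec // shift_bvec b_gt1.
by rewrite !scale1r !scale0r subr0 addr0.
Qed.

Lemma cocycle_exprbd x b d : (1 < b)%N -> (1 < d)%N ->
  E x (e b) (e d) = c b d *: N x.
Proof.
move=> b_gt1 d_gt1; rewrite cocycle_expr_shift !bcoef1_bvec //.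
by rewrite !scale0r !subr0 !addr0.
Qed.

(** The last two fields are what the arguments [(x_a, x_b, x_1)] and
[(x_a, x_1, x_b)] of the cocycle equation say, the second having been used to
eliminate [f (N x_a) x_b] from the first. *)
Record F1_cocycle : Prop := F1Cocycle {
  cocycle11 : c 1%N 1%N = 0;
  cocycle_bd b d : (1 < b <= n)%N -> (1 < d <= n)%N -> c b d = 0;
  cocycle_next a b : (0 < a <= n)%N -> (1 < b <= n)%N ->
    f (e a) (e b.+1) = - (c 1%N b + c b 1%N) *: N (e a);
  cocycle_shift a b : (0 < a <= n)%N -> (1 < b <= n)%N ->
    f (N (e a)) (e b) = c 1%N b *: N (e a) + N (f (e a) (e b))
}.

Lemma ZL2_bvec :
  (forall a b d, (0 < a <= n)%N -> (0 < b <= n)%N -> (0 < d <= n)%N ->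
     E (e a) (e b) (e d) = 0) ->
  f \in ZL2 (F1 K n).
Proof.
move=> E0; rewrite memv_ker; apply/eqP.
apply: lfun_bvec => a a_in; apply: lfun_bvec => b b_in.
by apply: lfun_bvec => d d_in; rewrite coboundaryE !zero_lfunE E0.
Qed.

Lemma F1_cocycleP : f \in ZL2 (F1 K n) <-> F1_cocycle.
Proof.
split=> [/mem_ZL2 f_cocycle | [f11 fbd fnext fshift]].
  have E0 x y z : E x y z = 0 := f_cocycle x y z.
  have shift x b (b_gt1 : (1 < b)%N) :
      f (N x) (e b) = c 1%N b *: N x + N (f x (e b)).
    by apply/eqP; rewrite eq_sym -subr_eq0 -cocycle_expr1b ?E0.
  split=> [|b d /andP[b_gt1 _] /andP[d_gt1 _]|a b _ /andP[b_gt1 _]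
          |a b _ /andP[b_gt1 _]].
  - by have /eqP := E0 (e 2%N) (e 1%N) (e 1%N);
      rewrite cocycle_expr11 scaler_eq0 (negPf shift2_neq0) orbF => /eqP.
  - by have /eqP := E0 (e 2%N) (e b) (e d);
      rewrite cocycle_exprbd // scaler_eq0 (negPf shift2_neq0) orbF => /eqP.
  (* Adding the equations at (x_a, x_b, x_1) and (x_a, x_1, x_b) cancels both
     terms in which N and f are composed. *)
  - have := E0 (e a) (e b) (e 1%N); rewrite cocycle_exprb1 // shift //.
    move/eqP; rewrite addrAC [_ + f _ _]addrC addr_eq0 => /eqP->.
    by rewrite addrACA [- _ + _]addrC subrr addr0 -scalerDl scaleNr addrC.
  - exact: shift.
apply: ZL2_bvec => a b d a_in b_in d_in.
have [-> | b_ne1] := eqVneq b 1%N; have [-> | d_ne1] := eqVneq d 1%N.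
- by rewrite cocycle_expr11 f11 scale0r.
- by rewrite cocycle_expr1b ?fshift ?subrr //; lia.
- have {b_ne1} b_gt1 : (1 < b <= n)%N by lia.
  rewrite cocycle_exprb1; last by lia.
  rewrite (fshift a b) // (fnext a b) //.
  have cancel (V : zmodType) (p q r : V) : p - q - (r + p) + (r + q) = 0.
    by rewrite addrAC (addrC r q) addrA subrK (addrC r p) subrr.
  by rewrite scaleNr scalerDl cancel.
- by rewrite cocycle_exprbd ?fbd ?scale0r //; lia.
Qed.
End Equations.

(** * Coordinates determining a cocycle *)

(** The triple [(a, b, k)] stands for the linear form [f |-> f(x_a, x_b)_k]. The
order is that of [ZL2_family], so that the two lists are matched by position. *)
Definition free_coords : seq (nat * nat * nat) :=
  [seq (j, 1, 1)%N | j <- index_iota 2 n]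
  ++ [seq (j, 1, k)%N | j <- index_iota 1 n.+1, k <- index_iota 2 n.+1]
  ++ [seq (2, 2, j)%N | j <- index_iota 2 n.+1]
  ++ [:: (1, 2, 1)%N; (1, 2, n)%N].

Definition dual_cocycle (i : nat * nat * nat) : cochain2 L :=
  let: (a, b, k) := i in
  if b == 1%N then if k == 1%N then phi1 K n a else phi K n a k
  else if a == 2%N then psi K n k else if k == 1%N then xi1 K n else xi2 K n.

Definition coord (i : nat * nat * nat) (f : cochain2 L) : K :=
  let: (a, b, k) := i in bcoef k (f (e a) (e b)).

Lemma coord_scalar i : scalar (coord i).
Proof.
case: i => [[a b] k] c f g.
by rewrite /coord !(add_lfunE, scale_lfunE) linearD scalarZ.
Qed.

Variant free_coords_spec : nat * nat * nat -> Prop :=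
  | CoordPhi1 j of (1 < j < n)%N : free_coords_spec (j, 1, 1)%N
  | CoordPhi j k of (0 < j <= n)%N & (1 < k <= n)%N :
      free_coords_spec (j, 1, k)%N
  | CoordPsi j of (1 < j <= n)%N : free_coords_spec (2, 2, j)%N
  | CoordXi1 : free_coords_spec (1, 2, 1)%N
  | CoordXi2 : free_coords_spec (1, 2, n)%N.

Lemma free_coordsP i : reflect (free_coords_spec i) (i \in free_coords).
Proof.
rewrite !mem_cat !inE; apply: (iffP or4P).
  case=> [/mapP[j]|/allpairsP[[j k] /= []]|/mapP[j]|/orP[]/eqP->];
    rewrite ?mem_index_iota.
  - by move=> j_in ->; constructor.
  - by move=> j_in k_in ->; constructor.
  - by move=> j_in ->; constructor.
  - by constructor.
  - by constructor.
case=> [j j_in | j k j_in k_in | j j_in | | ].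
- by constructor 1; apply/mapP; exists j; rewrite ?mem_index_iota.
- constructor 2; apply/allpairsP; exists (j, k).
  by split; rewrite ?mem_index_iota.
- by constructor 3; apply/mapP; exists j; rewrite ?mem_index_iota.
- by constructor 4; rewrite eqxx.
- by constructor 4; rewrite eqxx orbT.
Qed.

Hypothesis n_gt2 : (2 < n)%N.

Lemma ZL2_familyE : ZL2_family K n = [seq dual_cocycle i | i <- free_coords].
Proof.
rewrite /ZL2_family /free_coords !map_cat map_allpairs -!map_comp /=.
have -> : (n == 1)%N = false by lia.
congr (_ ++ (_ ++ _)).
by apply/eq_in_allpairs => j k _; rewrite mem_index_iota /=; case: eqP => // ->.
Qed.

Lemma free_coords_uniq : uniq free_coords.
Proof.
rewrite /free_coords !cat_uniq; apply/and4P; split.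
- by rewrite map_inj_uniq ?iota_uniq // => j k [].
- apply/hasPn => i; rewrite !mem_cat => ci; apply/mapP => -[j j_in def_i].
  move: ci; rewrite {i}def_i.
  case/or3P => [/allpairsP[[a k] /= [_]] | /mapP[k _]|].
  + by rewrite mem_index_iota => k_in [_ def_k]; lia.
  + by case.
  + by rewrite !inE !xpair_eqE /= !andbF.
- by rewrite allpairs_uniq ?iota_uniq // => -[j k] [j' k'] _ _ [-> ->].
- apply/andP; split.
    apply/hasPn => i; rewrite !mem_cat => ci.
    apply/allpairsP => -[[j k] /= [_ _ def_i]].
    move: ci; rewrite {i}def_i => /orP[/mapP[k' _ []] | ] //.
    by rewrite !inE !xpair_eqE /= !andbF.
  apply/and3P; split.
  + by rewrite map_inj_uniq ?iota_uniq // => j k [].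
  + by apply/hasPn => i; rewrite !inE => /orP[] /eqP ->; apply/mapP => -[].
  + by rewrite /= inE !xpair_eqE /=; lia.
Qed.

Lemma coord_bilin a b k h : (0 < a <= n)%N -> (0 < b <= n)%N ->
  coord (a, b, k) (bilin h) = bcoef k (h a b).
Proof. by move=> a_in b_in; rewrite /coord bilin_bvecE a_in b_in. Qed.

(** Each member of the family takes the value prescribed by its own triple on a
single pair of basis vectors among those inspected: the corrections forced by
the cocycle equation sit at [(x_a, x_b)] with [b >= 3], or at [(x_a, x_2)] with
[a >= 3]. *)
Lemma coord_dual :
  {in free_coords &, forall i j, coord i (dual_cocycle j) = (i == j)%:R}.
Proof.
have n_ne1 : (n == 1)%N = false by lia.
have n_gt0 : (0 < n)%N by lia.
have natr_false (b : bool) : ~~ b -> 0 = b%:R :> K by case: b.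
move=> i j /free_coordsP ci.
move=> /free_coordsP[{}j j_in | {}j k j_in k_in | {}j j_in | | ].
all: rewrite /dual_cocycle ?n_ne1 /= /phi1 /phi /psi /xi1 /xi2.
all: try have -> : (k == 1)%N = false by lia.
all: case: ci => [a a_in | a k' a_in k'_in | k' k'_in | | ].
all: rewrite coord_bilin ?xpair_eqE /=; try lia.
all: repeat (case: ifP => ?); try (by exfalso; lia).
all: rewrite ?bcoef_bvec ?linear0 ?n_gt0.
all: by [ | congr (nat_of_bool _)%:R; lia | apply: natr_false; lia].
Qed.

(** The cocycle equations on a table of structure constants, where the guards
[b < n] and [a < n] account for [x_(n+1) = 0]. *)
Lemma ZL2_bilin (h : nat -> nat -> L) :
  bcoef 1 (h 1 1)%N = 0 ->
  (forall b d, (1 < b <= n)%N -> (1 < d <= n)%N -> bcoef 1 (h b d) = 0) ->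
  (forall a b, (0 < a <= n)%N -> (1 < b <= n)%N ->
    (if (b < n)%N then h a b.+1 else 0)
      = - (bcoef 1 (h 1%N b) + bcoef 1 (h b 1%N))
        *: (if (1 < a)%N then e a.+1 else 0)) ->
  (forall a b, (0 < a <= n)%N -> (1 < b <= n)%N ->
    (if (1 < a < n)%N then h a.+1 b else 0)
      = bcoef 1 (h 1%N b) *: (if (1 < a)%N then e a.+1 else 0) + N (h a b)) ->
  bilin h \in ZL2 (F1 K n).
Proof.
move=> h11 hbd hnext hshift; apply/F1_cocycleP => //.
have hE a b : (0 < a <= n)%N -> (0 < b <= n)%N -> bilin h (e a) (e b) = h a b.
  exact: bilin_bvec.
split=> [|b d b_in d_in|a b a_in b_in|a b a_in b_in].
- by rewrite hE ?h11 //; lia.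
- by rewrite hE ?hbd //; lia.
- rewrite (hE 1%N b) ?(hE b 1%N) ?shift_bvec -?hnext //; try lia.
  rewrite bilin_bvecE a_in; congr (if _ then _ else _); lia.
rewrite !(hE _ b) ?shift_bvec -?hshift //; try lia.
case: (ltnP 1 a) => a_gt1; last by rewrite linear0 zero_lfunE.
by rewrite bilin_bvecE; congr (if _ then _ else _); lia.
Qed.

Lemma dual_cocycle_ZL2 :
  {in free_coords, forall i, dual_cocycle i \in ZL2 (F1 K n)}.
Proof.
have n_ne1 : (n == 1)%N = false by lia.
move=> i /free_coordsP[{}j j_in | {}j k j_in k_in | {}j j_in | | ].
all: rewrite /dual_cocycle ?n_ne1 /=; try have -> : (k == 1)%N = false by lia.
all: apply: ZL2_bilin => [|b d b_in d_in|a b a_in b_in|a b a_in b_in].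
all: repeat (case: ifP => ?); try (by exfalso; lia).
all: rewrite ?(linear0, linearN, linearZ, scalarZ) /=.
all: rewrite ?(scale_lfunE, opp_lfunE, zero_lfunE) ?shift_bvec.
all: rewrite ?(bcoef1 n_gt2) /=.
all: rewrite ?bcoef1_bvec; try lia.
all: rewrite ?(scaler0, addr0, oppr0, mulr0, scale0r, add0r).
all: rewrite ?(scaleN1r, scale1r) //.
all: repeat (case: ifP => ?); try (by exfalso; lia).
all: try by [congr (e _); lia | congr (- _) |
             rewrite !bvec_out ?(oppr0, scaler0, addr0) //; lia].
(* What is left is xi1 at (N x_a, x_2): its eigenvalue i - 2 on x_i grows by
   one along N, which is the term c(1, 2) N of the equation. *)
- rewrite (_ : (a.+1 - 2)%N = (a - 2).+1); last by lia.
  by rewrite mulrS scalerDl scale1r.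
- rewrite (_ : (a.+1 - 2)%N = 1%N); last by lia.
  by rewrite scale1r.
Qed.

(** The coordinates along [x_1] are treated first, because they are the scalars
through which the equations couple the operators [f(-, x_b)]. *)
Lemma cocycle_eq0 f :
  f \in ZL2 (F1 K n) -> {in free_coords, forall i, coord i f = 0} -> f = 0.
Proof.
move=> /(F1_cocycleP _ n_gt2)[f11 fbd fnext fshift] f0.
have N1 := shift1.
pose c a b := bcoef 1 (f (e a) (e b)).
have c1b b : (2 < b <= n)%N -> c 1%N b = 0.
  case: b => // b b_in; rewrite /c fnext ?N1 ?scaler0 ?linear0 //; lia.
have c12 : c 1%N 2%N = 0.
  by apply: (f0 (1, 2, 1)%N); apply/free_coordsP; constructor.
have c1 b : (1 < b <= n)%N -> c 1%N b = 0.
  by move=> b_in; have [-> // | b_ne2] := eqVneq b 2%N; apply: c1b; lia.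
have cb1 b : (1 < b <= n)%N -> c b 1%N = 0.
  move=> b_in; have [b_lt | b_ge] := ltnP b n.
    by apply: (f0 (b, 1, 1)%N); apply/free_coordsP; constructor; lia.
  (* The equation for f(x_2, x_(n+1)), where x_(n+1) = 0 but N x_2 <> 0. *)
  have -> : b = n by lia.
  have in2 : (0 < 2 <= n)%N by lia.
  have inn : (1 < n <= n)%N by lia.
  have := fnext 2%N n in2 inn; rewrite -/(c _ _) -/(c _ _) c1 // add0r.
  have -> : e n.+1 = 0 by apply: bvec_out; lia.
  rewrite linear0.
  move/esym/eqP; rewrite scaler_eq0 (negPf (shift2_neq0 n_gt2)) orbF.
  by rewrite oppr_eq0 => /eqP.
have D1 a : (0 < a <= n)%N -> f (e a) (e 1%N) = 0.
  move=> a_in; apply: bcoef_inj => k k_in; rewrite linear0.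
  have [-> | k_ne1] := eqVneq k 1%N.
    have [-> // | a_ne1] := eqVneq a 1%N; apply: cb1; lia.
  by apply: (f0 (a, 1, k)%N); apply/free_coordsP; constructor; lia.
have D3 a b : (0 < a <= n)%N -> (2 < b <= n)%N -> f (e a) (e b) = 0.
  case: b => // b a_in b_in; rewrite fnext //; last lia.
  by rewrite -/(c _ _) -/(c _ _) c1 ?cb1 ?addr0 ?oppr0 ?scale0r //; lia.
have D2 a : (0 < a <= n)%N -> f (e a) (e 2%N) = 0.
  have in2 : (1 < 2 <= n)%N by lia.
  elim: a => [|[_|a IHa]] // a_in.
    apply: bcoef_inj => k k_in; rewrite linear0.
    have [->|k_ne1] := eqVneq k 1%N; first exact: c12.
    have [->|k_nen] := eqVneq k n.
      by apply: (f0 (1, 2, n)%N); apply/free_coordsP; constructor.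
    (* Since N x_1 = 0, the vector f(x_1, x_2) lies in the kernel of N. *)
    rewrite -bcoef_shift; last by lia.
    have := fshift 1%N 2%N a_in in2.
    by rewrite N1 linear0 zero_lfunE scaler0 add0r => <-; rewrite linear0.
  case: a => [|a] in IHa a_in *.
    apply: bcoef_inj => k k_in; rewrite linear0.
    have [->|k_ne1] := eqVneq k 1%N; first exact: fbd.
    by apply: (f0 (2, 2, k)%N); apply/free_coordsP; constructor; lia.
  have := fshift a.+2 2%N; rewrite shift_bvec /= -/(c _ _) c12 scale0r add0r.
  move=> -> //; try lia.
  by rewrite IHa ?linear0 ?zero_lfunE //; lia.
apply: lfun_bvec => a a_in; apply: lfun_bvec => b b_in; rewrite !zero_lfunE.
case: (ltngtP b 2%N) => [b_lt2 | b_gt2 | ->]; last exact: D2.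
  by have -> : b = 1%N; [lia | apply: D1].
by apply: D3; lia.
Qed.
End Cocycles.

Theorem theorem3p2 (R : realType) (n : nat) :
  (3 <= n)%N -> basis_of (ZL2 (F1 R[i] n)) (ZL2_family R[i] n).
Proof.
move=> n_gt2; rewrite ZL2_familyE //.
apply: (@basis_of_dual _ _ _ _ _ _ (@coord R[i] n)).
- exact: free_coords_uniq.
- exact: coord_scalar.
- exact: coord_dual.
- exact: dual_cocycle_ZL2.
- exact: cocycle_eq0.
Qed.
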